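(* Let $n$ be a positive integer, let $S\subseteq\{1,\dots,n-1\}$ be closed under taking additive inverses modulo $n$, let $G=\operatorname{Circ}(n,S)$, and let $k$ be a nonnegative integer. The following are equivalent. (1) There exists a real (symmetric) positive semidefinite circulant matrix with rank $k$ and graph $G$. (2) There exists a cyclically symmetric orthogonal representation for $G$ over $\mathbb R$ with rank $k$. (3) There exists a nonnegative $x\in\mathbb R^n$ with weight $k$ such that $i\mapsto A_n^i x$ is an orthogonal representation for $G$. (4) There exists a balanced nonnegative $x\in\mathbb R^n$ with support of size $k$ such that $i\mapsto A_n^i x$ is an orthogonal representation for $G$.
   Context: Vectors and matrices are indexed from $0$. $\operatorname{Circ}(n,S)$ is the simple graph on $\{0,1,\dots,n-1\}$ in which $i,j$ are adjacent iff $(i-j)\bmod n\in S$. An $n\times n$ Hermitian (or real symmetric) matrix $A$ has graph $G$ (where $V(G)=\{0,\dots,n-1\}$) if for all $i\ne j$: $A_{ij}\neq 0$ iff $\{i,j\}\in E(G)$; diagonal entries are unrestricted. $A$ is a circulant matrix if $A_{ij}$ depends only on $i-j$ modulo $n$. An orthogonal representation for $G$ in $\mathbb R^d$ is a function $r:V(G)\to\mathbb R^d$ such that for distinct vertices $v,w$: $\langle r(v),r(w)\rangle\neq 0$ iff $\{v,w\}\in E(G)$. It is said to be over $\mathbb R$ (with $d$ arbitrary); its rank is the dimension of the span of its image. It is cyclically symmetric if there are a $d\times d$ unitary matrix $U$ with $U^n=I$ and a vector $x$ such that $r(i)=U^i x$ for all $i\in\{0,\dots,n-1\}$ (in the real case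 $U$ can equivalently be taken real orthogonal). $A_n$ is the real $n\times n$ matrix with all entries zero except: $(A_n)_{00}=1$; for each integer $1\le j<n/2$, $(A_n)_{jj}=(A_n)_{n-j,n-j}=\cos(2\pi j/n)$, $(A_n)_{j,n-j}=-\sin(2\pi j/n)$, $(A_n)_{n-j,j}=\sin(2\pi j/n)$; and, if $n$ is even, $(A_n)_{n/2,n/2}=-1$. It is orthogonal with $A_n^n=I$. A vector is nonnegative if all its coordinates are. The support $\operatorname{supp}(x)$ is the set of indices of nonzero coordinates. The weight of $x\in\mathbb R^n$ is the number of $i\in\{0,\dots,n-1\}$ with $i\in\operatorname{supp}(x)$ or $n-i\in\operatorname{supp}(x)$. The vector $x$ is balanced if $x_i=x_{n-i}$ for all $i\in\{1,\dots,n-1\}$. *)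

(* Defs.v *)
From mathcomp Require Import all_boot all_order all_algebra.
From mathcomp Require Import complex.
From mathcomp Require Import reals trigo.

Set Implicit Arguments.
Unset Strict Implicit.
Unset Printing Implicit Defensive.

Import Order.TTheory GRing.Theory Num.Theory.

Local Open Scope ring_scope.

(* Throughout, the positive integer n is written m.+1, and the index set
   {0, ..., n-1} is 'I_m.+1.  On indices, i - j and - i are those of its
   canonical zmodType structure, i.e. they are taken modulo n; in particular
   - i has value n - i for i != 0, and - 0 = 0. *)

Definition circ_graph (m : nat) (S : {set 'I_m.+1}) : rel 'I_m.+1 :=
  fun i j => i - j \in S.

Section Representations.
Variable R : realType.

Definition dotv (d : nat) (u v : 'cV[R]_d) : R :=
  \sum_(k < d) u k 0 * v k 0.

Definition orth_rep (V : finType) (G : rel V) (d : nat) (r : V -> 'cV[R]_d) :=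
  forall v w : V, v != w -> (dotv (r v) (r w) != 0 <-> G v w).

Definition rep_rank (V : finType) (d : nat) (r : V -> 'cV[R]_d) : nat :=
  \dim <<codom r>>%VS.

(* U and x are complex even though r is real. *)
Definition cyclically_symmetric (n d : nat) (r : 'I_n -> 'cV[R]_d) :=
  exists (U : 'M[R[i]]_d) (x : 'cV[R[i]]_d),
    [/\ U \is unitarymx, U ^+ n = 1
      & forall i : 'I_n, map_mx (real_complex R) (r i) = U ^+ i *m x].

End Representations.

Section Matrices.
Variables (R : realType) (m : nat).

Definition symmetric_mx (A : 'M[R]_m.+1) := A^T = A.

Definition positive_semidefinite (A : 'M[R]_m.+1) :=
  symmetric_mx A /\ forall v : 'cV[R]_m.+1, 0 <= (v^T *m A *m v) 0 0.

Definition circulant (A : 'M[R]_m.+1) :=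
  forall i j i' j' : 'I_m.+1, i - j = i' - j' -> A i j = A i' j'.

Definition has_graph (A : 'M[R]_m.+1) (G : rel 'I_m.+1) :=
  forall i j : 'I_m.+1, i != j -> (A i j != 0 <-> G i j).

Definition cyc_angle (j : nat) : R := 2 * pi * j%:R / m.+1%:R.

(* The matrix A_n.  The test i.*2 < n selects j = i, and j = n - i is used
   otherwise. *)
Definition cyc_mx : 'M[R]_m.+1 :=
  \matrix_(i, j)
    if i == j then
      if i == 0 then 1
      else if (i.*2 == m.+1)%N then -1
      else if (i.*2 < m.+1)%N then cos (cyc_angle i)
      else cos (cyc_angle (m.+1 - i))
    else if (i + j == m.+1)%N then
      if (i.*2 < m.+1)%N then - sin (cyc_angle i)
      else sin (cyc_angle j)
    else 0.

Definition nonneg_vec (x : 'cV[R]_m.+1) := forall i, 0 <= x i 0.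

Definition supp (x : 'cV[R]_m.+1) : {set 'I_m.+1} := [set i | x i 0 != 0].

Definition weight (x : 'cV[R]_m.+1) : nat :=
  #|[set i : 'I_m.+1 | (i \in supp x) || (- i \in supp x)]|.

(* The instance i = 0 is trivial. *)
Definition balanced (x : 'cV[R]_m.+1) := forall i, x i 0 = x (- i) 0.

End Matrices.

Arguments cyc_mx : clear implicits.

(* Main.v *)
Require Import Defs.
From mathcomp Require Import all_boot all_order all_algebra.
From mathcomp Require Import complex.
From mathcomp Require Import reals trigo.
From mathcomp Require Import ring lra zify.

Set Implicit Arguments.
Unset Strict Implicit.
Unset Printing Implicit Defensive.

Import Order.TTheory GRing.Theory Num.Theory.

Import VectorInternalTheory.
Local Open Scope ring_scope.

(** Every condition says that one and the same positive semidefinite circulant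
matrix M has rank k and the right zero pattern: in (1) the matrix itself, in
(2), (3) and (4) the Gram matrix of the representation, whose rank is the
dimension of the span of its vectors ([rank_gram]). The Gram matrix of a
cyclically symmetric family is circulant because a unitary U preserves inner
products ([circulant_gram]).

What remains is to recognise these matrices as Gram matrices of the orbits
i |-> A_n^i x. On the pair of coordinates l, -l the matrix A_n is the rotation
by 2 pi l / n, so that (A_n^t x)_l = cos(2 pi t l / n) x_l - sin(2 pi t l / n)
x_(-l) for every residue l ([cyc_mxX_mul]). In the inner product of A_n^i x and
A_n^j x the mixed terms are odd in l and cancel, which leaves

  sum_l x_l^2 cos(2 pi (i - j) l / n)          ([gram_cyc_orbit]).

So only the squares of the coordinates matter, and only through their
averages over l and -l: replacing x_l^2 by (x_l^2 + x_(-l)^2) / 2 gives a balanced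
vector with the same Gram matrix, supported where the weight of x is counted
([balance]). This is (3) => (4).

For an even family w (w_(-l) = w_l), the cosine matrix with entries
sum_l w_l cos(2 pi (i - j) l / n) equals H diag(w) H, where
H = (cos + sin)(2 pi i l / n) is the Hartley matrix, the real form of the
Fourier matrix, with H H = n ([cos_mx_hartley], [hartley_sqr]).
Hence its rank is the number of nonzero w_l ([rank_cos_mx]). Conversely a
symmetric circulant matrix is the cosine matrix of its discrete cosine
transform ([circulant_spectrum]); these weights are eigenvalues divided by n,
hence nonnegative when the matrix is positive semidefinite
([spectrum_ge0]), and their square roots form a balanced nonnegative x whose
orbit has that Gram matrix ([psd_circulant_orbit]). *)

(** * Gram matrices and ranks *)

Section GramMatrices.
Variable R : realType.

Lemma dotvE d (u v : 'cV[R]_d) : dotv u v = (u^T *m v) 0 0.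
Proof. by rewrite mxE; apply: eq_bigr => k _; rewrite mxE. Qed.

Lemma dotvv_ge0 d (u : 'cV[R]_d) : 0 <= dotv u u.
Proof. by apply: sumr_ge0 => k _; rewrite -expr2 sqr_ge0. Qed.

Lemma dotvv_eq0 d (u : 'cV[R]_d) : dotv u u = 0 -> u = 0.
Proof.
move=> u0; apply/colP => k; rewrite mxE; apply/eqP.
rewrite -(sqrf_eq0 (u k 0)) expr2; move/eqP: u0.
rewrite psumr_eq0; last by move=> l _; rewrite -expr2 sqr_ge0.
by move/allP/(_ k); rewrite mem_index_enum => /(_ isT).
Qed.

(** Over the reals v M M^T = 0 forces |v M|^2 = 0, so M and M M^T have the
same left kernel. *)
Lemma rank_mul_tr p d (M : 'M[R]_(p, d)) : \rank (M *m M^T) = \rank M.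
Proof.
apply/eqP; rewrite eqn_leq mxrankM_maxl /=.
have kerM : (kermx (M *m M^T) <= kermx M)%MS.
  apply/rV_subP => v /sub_kermxP vG; apply/sub_kermxP.
  apply: trmx_inj; rewrite trmx0; apply: dotvv_eq0.
  by rewrite dotvE trmxK trmx_mul mulmxA -(mulmxA v) vG mul0mx mxE.
have := mxrankS kerM; rewrite !mxrank_ker.
by have := rank_leq_row (M *m M^T); have := rank_leq_row M; lia.
Qed.

Definition gram n d (r : 'I_n -> 'cV[R]_d) : 'M[R]_n :=
  \matrix_(i, j) dotv (r i) (r j).

(** The dimension of a span is by definition the rank of a matrix of
coordinates in an unspecified basis; the coordinate isomorphism is an
invertible factor P between that matrix and the one with rows [r i]. *)
Lemma rank_rows n d (r : 'I_n -> 'cV[R]_d) :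
  rep_rank r = \rank (\matrix_i (r i)^T).
Proof.
rewrite /rep_rank /dimv [@span _ _]unlock mxrank_gen.
set B := b2mx _; set M := (\matrix_i _).
pose P := lin1_mx (trmx \o @r2v R 'cV[R]_d : 'rV[R]__ -> 'rV[R]_d).
pose Q := lin1_mx (@v2r R 'cV[R]_d \o trmx : 'rV[R]_d -> 'rV[R]__).
have freeP : row_free P.
  apply/row_freeP; exists Q; apply/row_matrixP => i.
  by rewrite row_mul rowE !mul_rV_lin1 /= trmxK r2vK row1.
have PE (v : 'cV[R]_d) : v2r v *m P = v^T.
  by rewrite mul_rV_lin1 /= v2rK.
rewrite -(mxrankMfree B freeP); apply/eqmx_rank/andP; split.
  apply/row_subP => i; rewrite row_mul rowK PE.
  have /codomP[j ->] : tnth (in_tuple (codom r)) i \in codom r by exact: mem_tnth.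
  by rewrite -(rowK (fun i => (r i)^T) j) row_sub.
apply/row_subP => j; rewrite rowK.
have lt_j : (index (r j) (codom r) < size (codom r))%N.
  by rewrite index_mem codom_f.
have <- : row (Ordinal lt_j) (B *m P) = (r j)^T.
  rewrite row_mul rowK PE.
  by rewrite (tnth_nth 0) /= nth_index ?codom_f.
exact: row_sub.
Qed.

Lemma gramE n d (r : 'I_n -> 'cV[R]_d) :
  gram r = (\matrix_i (r i)^T) *m (\matrix_i (r i)^T)^T.
Proof. by apply/matrixP => i j; rewrite !mxE; apply: eq_bigr => k _; rewrite !mxE. Qed.

Lemma rank_gram n d (r : 'I_n -> 'cV[R]_d) : \rank (gram r) = rep_rank r.
Proof. by rewrite gramE rank_mul_tr rank_rows. Qed.

Lemma gram_psd m d (r : 'I_m.+1 -> 'cV[R]_d) : positive_semidefinite (gram r).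
Proof.
split=> [|v]; first by rewrite /symmetric_mx gramE trmx_mul trmxK.
rewrite gramE mulmxA -mulmxA; set M := (\matrix_i _).
by rewrite -[v^T *m M]trmxK trmx_mul trmxK -dotvE dotvv_ge0.
Qed.

Lemma rank_diag n (w : 'rV[R]_n) : \rank (diag_mx w) = #|[set i | w 0 i != 0]|.
Proof.
have -> : \rank (diag_mx w) =
    \rank (\sum_(i | w 0 i != 0) <<'e_i : 'rV[R]_n>>)%MS.
  apply/eqmx_rank/andP; split.
    apply/row_subP => i; rewrite row_diag_mx.
    have [->|wi] := eqVneq (w 0 i) 0; first by rewrite scale0r sub0mx.
    by apply/scalemx_sub/(sumsmx_sup i) => //; rewrite genmxE.
  apply/sumsmx_subP => i wi; rewrite genmxE.
  have -> : 'e_i = (w 0 i)^-1 *: row i (diag_mx w).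
    by rewrite row_diag_mx scalerA mulVf // scale1r.
  exact/scalemx_sub/row_sub.
have /mxdirectP /= -> :=
  @mxdirect_delta R _ (fun i => w 0 i != 0) n id (in2W (@inj_id _)).
under eq_bigr do rewrite mxrank_gen mxrank_delta.
by rewrite sum1dep_card.
Qed.

End GramMatrices.

(** * Trigonometric functions of the angles 2 pi k / n *)

Section RootsOfUnity.
Variables (R : realType) (m : nat).
Local Notation n := m.+1.
Local Notation c k := (cos (cyc_angle R m k)).
Local Notation s k := (sin (cyc_angle R m k)).

Lemma cyc_angleD a b : cyc_angle R m (a + b) = cyc_angle R m a + cyc_angle R m b.
Proof. by rewrite /cyc_angle natrD mulrDr mulrDl. Qed.

Lemma cyc_angle_period a q :
  c (a + q * n) = c a /\ s (a + q * n) = s a.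
Proof.
elim: q => [|q [IHc IHs]]; first by rewrite addn0.
have -> : cyc_angle R m (a + q.+1 * n) = cyc_angle R m (a + q * n) + pi *+ 2.
  have n0 : n%:R != 0 :> R by rewrite pnatr_eq0.
  rewrite mulSn addnCA cyc_angleD addrC; congr (_ + _).
  by rewrite /cyc_angle mulfK // mulr_natl.
by rewrite cosD2pi sinD2pi.
Qed.

Lemma cos_modn a b : a = b %[mod n] -> c a = c b.
Proof.
move=> ab; rewrite (divn_eq a n) (divn_eq b n) ab ![(_ + _ %% n)%N]addnC.
by rewrite !(proj1 (cyc_angle_period _ _)).
Qed.

Lemma sin_modn a b : a = b %[mod n] -> s a = s b.
Proof.
move=> ab; rewrite (divn_eq a n) (divn_eq b n) ab ![(_ + _ %% n)%N]addnC.
by rewrite !(proj2 (cyc_angle_period _ _)).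
Qed.

Lemma cos_cyc0 : c 0 = 1. Proof. by rewrite /cyc_angle mulr0 mul0r cos0. Qed.
Lemma sin_cyc0 : s 0 = 0. Proof. by rewrite /cyc_angle mulr0 mul0r sin0. Qed.

Lemma cos_cycD a b : c (a + b) = c a * c b - s a * s b.
Proof. by rewrite cyc_angleD cosD. Qed.

Lemma sin_cycD a b : s (a + b) = s a * c b + c a * s b.
Proof. by rewrite cyc_angleD sinD. Qed.

(** The point at angle a is the conjugate of the point at angle b as soon as
their product is 1; multiplying out by cos^2 + sin^2 = 1 avoids any case
distinction on residues. *)
Lemma cyc_angle_opp a b : a + b = 0 %[mod n] -> c a = c b /\ s a = - s b.
Proof.
move=> ab; have := cos_modn ab; have := sin_modn ab.
rewrite cos_cyc0 sin_cyc0 cos_cycD sin_cycD => es ec.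
have eb : c b ^+ 2 + s b ^+ 2 = 1 := cos2Dsin2 _.
split.
- transitivity (c a * (c b ^+ 2 + s b ^+ 2)); first by rewrite eb mulr1.
  transitivity (c b * (c a * c b - s a * s b) + s b * (s a * c b + c a * s b)).
    by ring.
  by rewrite es ec mulr1 mulr0 addr0.
- transitivity (s a * (c b ^+ 2 + s b ^+ 2)); first by rewrite eb mulr1.
  transitivity (- s b * (c a * c b - s a * s b) + c b * (s a * c b + c a * s b)).
    by ring.
  by rewrite es ec mulr1 mulr0 addr0.
Qed.

Lemma val_ordD (i j : 'I_n) : i + j = (i + j)%R %[mod n].
Proof. by rewrite modn_mod. Qed.

Lemma val_ordN (i : 'I_n) : i + (- i)%R = 0 %[mod n].
Proof. by rewrite val_ordD subrr. Qed.

Lemma cosMN (i : 'I_n) k : c ((- i)%R * k) = c (i * k).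
Proof.
apply: (proj1 (cyc_angle_opp _)).
by rewrite -mulnDl -modnMml addnC val_ordN mod0n.
Qed.

Lemma sinMN (i : 'I_n) k : s ((- i)%R * k) = - s (i * k).
Proof.
apply: (proj2 (cyc_angle_opp _)).
by rewrite -mulnDl -modnMml addnC val_ordN mod0n.
Qed.

Lemma cosMNr k (l : 'I_n) : c (k * (- l)%R) = c (k * l).
Proof. by rewrite mulnC cosMN mulnC. Qed.

Lemma sinMNr k (l : 'I_n) : s (k * (- l)%R) = - s (k * l).
Proof. by rewrite mulnC sinMN mulnC. Qed.

Lemma cosMD (i j : 'I_n) k :
  c ((i + j)%R * k) = c (i * k) * c (j * k) - s (i * k) * s (j * k).
Proof.
by rewrite -cos_cycD -mulnDl; apply: cos_modn; rewrite -modnMml -val_ordD modnMml.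
Qed.

Lemma sinMD (i j : 'I_n) k :
  s ((i + j)%R * k) = s (i * k) * c (j * k) + c (i * k) * s (j * k).
Proof.
by rewrite -sin_cycD -mulnDl; apply: sin_modn; rewrite -modnMml -val_ordD modnMml.
Qed.

Lemma sum_oppI (F : 'I_n -> R) : \sum_l F l = \sum_l F (- l).
Proof. by rewrite (reindex_inj (@oppr_inj 'I_n)). Qed.

Lemma sum_odd (F : 'I_n -> R) : (forall l, F (- l) = - F l) -> \sum_l F l = 0.
Proof.
move=> Fodd; have := sum_oppI F.
by under [RHS]eq_bigr do rewrite Fodd; rewrite sumrN => ?; lra.
Qed.

(** With theta = 2 h, cos theta = 1 - 2 (sin h)^2 and h lies strictly between 0
and pi. *)
Lemma cos_cyc_neq1 k : (0 < k < n)%N -> c k != 1.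
Proof.
move=> /andP[k0 kn]; pose h : R := pi * k%:R / n%:R.
have n0 : 0 < n%:R :> R by rewrite ltr0n.
have -> : cyc_angle R m k = h *+ 2.
  by rewrite /cyc_angle /h; ring.
have : 0 < sin h.
  apply: sin_gt0_pi; rewrite /h divr_gt0 ?mulr_gt0 ?pi_gt0 ?ltr0n //=.
  by rewrite ltr_pdivrMr // ltr_pM2l ?pi_gt0 // ltr_nat.
have := cos2Dsin2 h; rewrite cos_mulr2n => e s0.
by apply/eqP => e1; nra.
Qed.

Lemma sum_sin k : \sum_(l < n) s (k * l) = 0.
Proof. by apply: sum_odd => l; rewrite sinMNr. Qed.

(** Shifting the summation index by 1 turns the sum C into
C cos theta - D sin theta, where D = 0 is the corresponding sum of sines, and
cos theta is not 1 for k nonzero. *)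
Lemma sum_cos (k : 'I_n) : \sum_(l < n) c (k * l) = n%:R *+ (k == 0).
Proof.
have [->|k0] := eqVneq k 0.
  under eq_bigr do rewrite mul0n cos_cyc0.
  by rewrite sumr_const card_ord.
have c1 : c k != 1.
  apply: cos_cyc_neq1; rewrite ltn_ord andbT lt0n.
  by apply: contra k0 => /eqP k0; apply/eqP/val_inj.
(* For n = 1 the index 1 does not exist in 'I_n, but then k = 0. *)
have [m0|m_gt0] := posnP m.
  by move: k0; rewrite -val_eqE /=; have := ltn_ord k; rewrite {2}m0 ltnS leqn0 => ->.
set S := \sum_l _; suff: (1 - c k) * S = 0.
  by move/eqP; rewrite mulf_eq0 subr_eq0 eq_sym (negbTE c1) /= => /eqP.
have : S = c k * S - s k * \sum_(l < n) s (k * l).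
  rewrite {1}/S (reindex_inj (@addrI 'I_n (inord 1))) /=.
  under eq_bigr do rewrite mulnC cosMD inordK ?ltnS // mul1n ![(_ * k)%N]mulnC.
  by rewrite sumrB !mulr_sumr.
by rewrite sum_sin => e; lra.
Qed.

End RootsOfUnity.

(** * Circulant matrices and the Hartley transform *)

Section CosineMatrices.
Variables (R : realType) (m : nat).
Local Notation n := m.+1.
Local Notation c k := (cos (cyc_angle R m k)).
Local Notation s k := (sin (cyc_angle R m k)).

Definition cos_mx (w : 'rV[R]_n) : 'M[R]_n :=
  \matrix_(i, j) \sum_l w 0 l * c ((i - j)%R * l).

(** The real orthogonal (up to the factor n) substitute for the Fourier
matrix; it is symmetric and its square is scalar, so that circulant symmetric
matrices are diagonalised without leaving the reals. *)
Definition hartley_mx : 'M[R]_n := \matrix_(i, l) (c (i * l) + s (i * l)).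

Lemma cosMB (i j : 'I_n) k :
  c ((i - j)%R * k) = c (i * k) * c (j * k) + s (i * k) * s (j * k).
Proof. by rewrite cosMD cosMN sinMN mulrN opprK. Qed.

Lemma hartley_mul (i j l : 'I_n) :
  hartley_mx i l * hartley_mx l j = c ((i - j)%R * l) + s ((i + j)%R * l).
Proof. by rewrite !mxE cosMB sinMD ![(l * j)%N]mulnC; ring. Qed.

Lemma hartley_sqr : hartley_mx *m hartley_mx = n%:R%:M.
Proof.
apply/matrixP => i j; rewrite !mxE.
under eq_bigr do rewrite hartley_mul.
by rewrite big_split sum_cos sum_sin [LHS]addr0 subr_eq0.
Qed.

Lemma hartley_unit : hartley_mx \in unitmx.
Proof.
have : hartley_mx *m (n%:R^-1 *: hartley_mx) = 1%:M.
  by rewrite -scalemxAr hartley_sqr scale_scalar_mx mulVf ?pnatr_eq0.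
by case/mulmx1_unit.
Qed.

Lemma tr_hartley : hartley_mx^T = hartley_mx.
Proof. by apply/matrixP => i j; rewrite !mxE mulnC. Qed.

(** The entries of the right-hand side are the wanted cosine sums plus
sum_l w_l sin(2 pi (i + j) l / n), whose terms are odd in l. *)
Lemma cos_mx_hartley (w : 'rV[R]_n) : (forall l, w 0 (- l) = w 0 l) ->
  cos_mx w = hartley_mx *m diag_mx w *m hartley_mx.
Proof.
move=> w_even; rewrite mul_mx_diag; apply/matrixP => i j.
rewrite mxE [RHS]mxE.
under [RHS]eq_bigr => l _ do
  rewrite mxE mulrAC hartley_mul mulrC mulrDr.
rewrite big_split /= [X in _ + X]sum_odd ?addr0 // => l.
by rewrite w_even sinMNr mulrN.
Qed.

Lemma rank_cos_mx (w : 'rV[R]_n) : (forall l, w 0 (- l) = w 0 l) ->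
  \rank (cos_mx w) = #|[set l | w 0 l != 0]|.
Proof.
move=> /cos_mx_hartley ->; rewrite -rank_diag.
rewrite mxrankMfree ?row_free_unit ?hartley_unit //.
by apply/eqmx_rank/eqmxP/eqmxMfull; rewrite row_full_unit hartley_unit.
Qed.

Lemma sum_cos_cos (t u : 'I_n) :
  \sum_(l < n) c (t * l) * c (u * l) =
    n%:R / 2 * ((t == u)%:R + (t == - u)%:R).
Proof.
have -> : \sum_(l < n) c (t * l) * c (u * l) =
    \sum_(l < n) (c ((t - u)%R * l) + c ((t + u)%R * l)) / 2.
  by apply: eq_bigr => l _; rewrite cosMB cosMD; field.
rewrite -mulr_suml big_split !sum_cos /= subr_eq0 addr_eq0.
by rewrite -![n%:R *+ _]mulr_natr; ring.
Qed.

(** The eigenvalues of a symmetric circulant matrix, divided by n: the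
normalisation makes them the weights of its cosine expansion. *)
Definition spectrum (A : 'M[R]_n) : 'rV[R]_n :=
  \row_l (n%:R^-1 * \sum_t A t 0 * c (t * l)).

Lemma spectrum_even A l : spectrum A 0 (- l) = spectrum A 0 l.
Proof.
rewrite !mxE; congr (_ * _); apply: eq_bigr => t _.
by rewrite cosMNr.
Qed.

(** Fourier inversion: by orthogonality of the cosines, the expansion at u is the
mean of the entries at u and -u, which agree by symmetry. *)
Lemma circulant_spectrum (A : 'M[R]_n) :
  symmetric_mx A -> circulant A -> A = cos_mx (spectrum A).
Proof.
move=> symA circA; apply/matrixP => i j; rewrite mxE.
set u := i - j.
have -> : A i j = A u 0 by apply: circA; rewrite subr0.
have A_even : A (- u) 0 = A u 0.
  by rewrite (circA (- u) 0 0 u) ?subr0 ?sub0r // -{1}symA mxE.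
under eq_bigr => l _ do rewrite mxE -mulrA mulr_suml.
rewrite -mulr_sumr exchange_big /=.
have -> : \sum_t \sum_(l < n) A t 0 * c (t * l) * c (u * l) =
    \sum_t (n%:R / 2 * (A t 0 * (t == u)%:R) + n%:R / 2 * (A t 0 * (t == - u)%:R)).
  apply: eq_bigr => t _; under eq_bigr do rewrite -mulrA.
  by rewrite -mulr_sumr sum_cos_cos; ring.
have pick v : \sum_t A t 0 * (t == v)%:R = A v 0.
  rewrite (bigD1 v) //= eqxx mulr1 big1 ?addr0 // => t /negbTE ->.
  by rewrite mulr0.
rewrite big_split /= -!mulr_sumr !pick A_even.
by field; rewrite nat1r pnatr_eq0.
Qed.

(** The quadratic form H D H, taken at the column l of H, is n^2 times the
entry l of D, since H H = n. *)
Lemma spectrum_ge0 (A : 'M[R]_n) l :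
  positive_semidefinite A -> circulant A -> 0 <= spectrum A 0 l.
Proof.
move=> [symA psdA] circA.
have := psdA (hartley_mx *m delta_mx l 0).
have {1}-> : A = hartley_mx *m diag_mx (spectrum A) *m hartley_mx.
  by rewrite -cos_mx_hartley; [exact: circulant_spectrum | exact: spectrum_even].
rewrite trmx_mul tr_hartley !mulmxA -(mulmxA _ hartley_mx hartley_mx) hartley_sqr.
rewrite -(mulmxA _ hartley_mx hartley_mx) hartley_sqr.
rewrite !mul_mx_scalar -!scalemxAl trmx_delta -rowE -colE !mxE eqxx mulr1n.
by rewrite !pmulr_rge0 ?invr_gt0 ?ltr0n.
Qed.

End CosineMatrices.

(** * Orbits of the matrix A_n *)

Section CyclicOrbits.
Variables (R : realType) (m : nat).
Local Notation n := m.+1.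
Local Notation c k := (cos (cyc_angle R m k)).
Local Notation s k := (sin (cyc_angle R m k)).
Implicit Type x : 'cV[R]_n.

Lemma ord_eqN (i j : 'I_n) : (j == - i) = (i + j == 0)%N || (i + j == n)%N.
Proof.
rewrite -addr_eq0 addrC -val_eqE /=.
have := ltn_ord i; have := ltn_ord j => ltj lti.
have [lt|ge] := ltnP (i + j) n; first by rewrite modn_small //; lia.
have -> : (i + j)%N = (i + j - n + n)%N by lia.
by rewrite modnDr modn_small; lia.
Qed.

(** A formula without cases for A_n: with indices modulo n, the row l has cos at
column l and - sin at column -l, for the angle 2 pi l / n itself. For l > n/2 the
angle is reflected, which flips the sign of the sine; for l = 0 and l = n/2
the two columns coincide but the sine vanishes. *)
Lemma cyc_mxE (i j : 'I_n) :
  cyc_mx R m i j = c i *+ (j == i) - s i *+ (j == - i).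
Proof.
rewrite mxE ord_eqN eq_sym; have := ltn_ord i; have := ltn_ord j => ltj lti.
have half : i.*2 = n -> cyc_angle R m i = pi.
  move=> e; have n0 : n%:R != 0 :> R by rewrite pnatr_eq0.
  have -> : pi = pi * n%:R / n%:R :> R by rewrite mulfK.
  by rewrite -[in X in _ = X / _]e -addnn natrD /cyc_angle; congr (_ / _); ring.
have flip : (0 < i)%N -> c (n - i) = c i /\ s (n - i) = - s i.
  by move=> i0; apply: cyc_angle_opp; rewrite subnK ?modnn ?mod0n // ltnW.
have [->|ij] := eqVneq j i; rewrite ?mulr1n.
  have [->|i0] := eqVneq i 0.
    by rewrite /= cos_cyc0 sin_cyc0 mul0rn subr0.
  have {}i0 : (0 < i)%N by rewrite lt0n -(inj_eq val_inj) in i0 *.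
  have [/half ->|nhalf] := eqVneq i.*2 n.
    by rewrite cospi sinpi mul0rn subr0.
  have -> : ((i + i == 0) || (i + i == n))%N = false by lia.
  by rewrite subr0; case: ifP => // _; rewrite (proj1 (flip i0)).
have ijn : nat_of_ord j != i by [].
have -> : (i + j == 0)%N = false by lia.
rewrite mulr0n sub0r /=.
have [ijS|_] := eqVneq (i + j)%N n; last by rewrite mulr0n oppr0.
rewrite mulr1n; case: ifP => // _.
have -> : nat_of_ord j = (n - i)%N by lia.
by rewrite (proj2 (flip _)) //; lia.
Qed.

Lemma cyc_mx_mul x l : (cyc_mx R m *m x) l 0 = c l * x l 0 - s l * x (- l) 0.
Proof.
rewrite mxE; under eq_bigr do rewrite cyc_mxE mulrBl.
rewrite sumrB (bigD1 l) //= eqxx big1 ?addr0; last first.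
  by move=> j /negbTE ->; rewrite mul0r.
rewrite (bigD1 (- l)) //= eqxx big1 ?addr0 // => j /negbTE ->.
by rewrite mul0r.
Qed.

Lemma cyc_mxX_mul t x l :
  (cyc_mx R m ^+ t *m x) l 0 = c (t * l) * x l 0 - s (t * l) * x (- l) 0.
Proof.
elim: t l => [|t IHt] l.
  by rewrite expr0 mul1mx mul0n cos_cyc0 sin_cyc0 mul1r mul0r subr0.
rewrite exprS -mulmxA cyc_mx_mul !IHt opprK mulSn cos_cycD sin_cycD.
rewrite cosMNr sinMNr mulnC.
by ring.
Qed.

Definition cyc_orbit x : 'I_n -> 'cV[R]_n := fun i => cyc_mx R m ^+ i *m x.

(** Expanding the product gives squares of x_l weighted by cos cos, squares of
x_(-l) weighted by sin sin, and mixed terms x_l x_(-l) times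
sin(2 pi (i + j) l / n). The mixed terms are odd in l, and reindexing by
l |-> -l merges the squares by the subtraction formula for the cosine. *)
Lemma gram_cyc_orbit x : gram (cyc_orbit x) = cos_mx (\row_l (x l 0 ^+ 2)).
Proof.
apply/matrixP => i j; rewrite !mxE /dotv.
transitivity (\sum_l (x l 0 ^+ 2 * (c (i * l) * c (j * l))
    + x (- l) 0 ^+ 2 * (s (i * l) * s (j * l))
    - (s (i * l) * c (j * l) + c (i * l) * s (j * l)) * (x l 0 * x (- l) 0))).
  by apply: eq_bigr => l _; rewrite !cyc_mxX_mul; ring.
rewrite sumrB [X in _ - X]sum_odd ?subr0; last first.
  by move=> l; rewrite opprK !cosMNr !sinMNr; ring.
rewrite big_split /= [X in _ + X]sum_oppI -big_split /=.
apply: eq_bigr => l _; rewrite opprK mxE cosMB.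
by rewrite !sinMNr; ring.
Qed.

End CyclicOrbits.

(** * Cyclically symmetric representations *)

Section Representations.
Variables (R : realType) (m : nat).
Local Notation n := m.+1.
Local Notation c k := (cos (cyc_angle R m k)).
Local Notation s k := (sin (cyc_angle R m k)).

Lemma col_mulmx p q (A : 'M[R]_(p, n)) (B : 'M[R]_(n, q)) j :
  col j (A *m B) = A *m col j B.
Proof. by rewrite !colE mulmxA. Qed.

Lemma cyc_mx_orthogonal : cyc_mx R m *m (cyc_mx R m)^T = 1%:M.
Proof.
have cN (i : 'I_n) : c (- i)%R = c i by have := cosMN R i 1; rewrite !muln1.
have sN (i : 'I_n) : s (- i)%R = - s i by have := sinMN R i 1; rewrite !muln1.
apply/matrixP => i j.
have -> : (cyc_mx R m *m (cyc_mx R m)^T) i j =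
    (cyc_mx R m *m col j (cyc_mx R m)^T) i 0 by rewrite -col_mulmx [RHS]mxE.
have entry k : col j (cyc_mx R m)^T k 0 = cyc_mx R m j k by rewrite !mxE.
rewrite cyc_mx_mul !entry !cyc_mxE mxE eqr_opp eqr_oppLR.
have [-> | ij] := eqVneq i j.
  rewrite !mulr1n -[RHS](cos2Dsin2 (cyc_angle R m j)).
  (* If j = -j, the cosine and sine entries overlap, but the sine is 0. *)
  have [jN|_] := eqVneq j (- j); last by rewrite !mulr0n; ring.
  have s0 : s j = 0 by have := sN j; rewrite -jN => ?; lra.
  by rewrite s0 !mulr1n; ring.
have [-> | _] := eqVneq i (- j); last by rewrite !mulr0n; ring.
by rewrite cN sN !mulr1n !mulr0n; ring.
Qed.

Lemma cyc_mx_order : cyc_mx R m ^+ n = 1.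
Proof.
rewrite -[LHS]mulmx1; apply/matrixP => i j.
have -> : (cyc_mx R m ^+ n *m 1%:M) i j = (cyc_mx R m ^+ n *m col j 1%:M) i 0.
  by rewrite -col_mulmx [RHS]mxE.
rewrite cyc_mxX_mul (@cos_modn _ _ _ 0) ?(@sin_modn _ _ _ 0) ?modnMr ?mod0n //.
by rewrite cos_cyc0 sin_cyc0 mul1r mul0r subr0 mxE.
Qed.

Lemma cyc_orbit_symmetric (x : 'cV[R]_n) : cyclically_symmetric (cyc_orbit x).
Proof.
pose f : {rmorphism R -> R[i]} := real_complex R.
exists (map_mx f (cyc_mx R m)), (map_mx f x); split.
- apply/unitarymxP.
  have -> : map_mx Num.conj (map_mx f (cyc_mx R m))^T = map_mx f (cyc_mx R m)^T.
    by apply/matrixP => i j; rewrite !mxE; exact: conjc_real.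
  by rewrite -map_mxM cyc_mx_orthogonal map_mx1.
- by rewrite -rmorphXn /= cyc_mx_order map_mx1.
- by move=> i; rewrite map_mxM rmorphXn.
Qed.

(** Since U^n = 1, U^t maps r i to r (t + i) with indices modulo n; being
unitary, it shows that the inner products are invariant under simultaneous
shifts. They are computed over the complex numbers, where conjugation fixes
the real vectors. *)
Lemma circulant_gram d (r : 'I_n -> 'cV[R]_d) :
  cyclically_symmetric r -> circulant (gram r).
Proof.
move=> [U [x [unitU Un rE]]].
have shift t i : map_mx (real_complex R) (r (t + i)) =
    U ^+ t *m map_mx (real_complex R) (r i).
  rewrite !rE mulmxA -[U ^+ t *m U ^+ i]exprD; congr (_ *m _).
  by rewrite (divn_eq (t + i) n) exprD mulnC exprM Un expr1n mul1r.
have unitX t : U ^+ t \is unitarymx.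
  elim: t => [|t IHt]; last by rewrite exprS mul_unitarymx.
  by apply/unitarymxP; rewrite trmx1 map_mx1 mulmx1.
have gramE i j : real_complex R (dotv (r i) (r j)) =
    ((map_mx (real_complex R) (r i))^T *m
      map_mx Num.conj (map_mx (real_complex R) (r j))) 0 0.
  rewrite rmorph_sum mxE; apply: eq_bigr => k _; rewrite !mxE rmorphM.
  by congr (_ * _); symmetry; exact: conjc_real.
have gram_shift t i j : gram r (t + i) (t + j) = gram r i j.
  rewrite !mxE; apply: complexI; rewrite !gramE !shift.
  rewrite trmx_mul map_mxM mulmxA -(mulmxA _ _ (map_mx _ (U ^+ t))).
  have -> : (U ^+ t)^T *m map_mx Num.conj (U ^+ t) = 1%:M.
    have := unitX t; rewrite -trmx_unitary => /unitarymxP.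
    by rewrite trmxK.
  by rewrite mulmx1.
move=> i j i' j' e.
rewrite -(gram_shift (i' - i)) subrK -addrA [- i + j]addrC -opprB e opprB.
by rewrite addrCA subrr addr0.
Qed.

Lemma gram_cyc_rank (x : 'cV[R]_n) :
  balanced x -> \rank (gram (cyc_orbit x)) = #|supp x|.
Proof.
move=> x_even; rewrite gram_cyc_orbit rank_cos_mx => [|l]; last by rewrite !mxE -x_even.
by apply: eq_card => l; rewrite !inE mxE sqrf_eq0.
Qed.

Lemma balanced_weight (x : 'cV[R]_n) : balanced x -> weight x = #|supp x|.
Proof. by move=> x_even; apply: eq_card => l; rewrite !inE -x_even orbb. Qed.

(** The cosine expansion of A has nonnegative even weights; these are the
squares of the coordinates of x. *)
Lemma psd_circulant_orbit (A : 'M[R]_n) :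
  positive_semidefinite A -> circulant A ->
  exists x, [/\ balanced x, nonneg_vec x & A = gram (cyc_orbit x)].
Proof.
move=> psdA circA; exists (\col_l Num.sqrt (spectrum A 0 l)); split.
- by move=> l; rewrite mxE [RHS]mxE spectrum_even.
- by move=> l; rewrite mxE sqrtr_ge0.
rewrite gram_cyc_orbit {1}(circulant_spectrum (proj1 psdA) circA).
by congr cos_mx; apply/rowP => l; rewrite [RHS]mxE [in RHS]mxE sqr_sqrtr ?spectrum_ge0.
Qed.

(** Averaging the squared coordinates over l and -l leaves the Gram matrix
unchanged because the cosine is even in l. *)
Lemma balance (x : 'cV[R]_n) : exists y, [/\ balanced y, nonneg_vec y,
  #|supp y| = weight x & gram (cyc_orbit y) = gram (cyc_orbit x)].
Proof.
pose y : 'cV[R]_n := \col_l Num.sqrt ((x l 0 ^+ 2 + x (- l) 0 ^+ 2) / 2).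
have mean_ge0 l : 0 <= (x l 0 ^+ 2 + x (- l) 0 ^+ 2) / 2.
  by rewrite divr_ge0 // addr_ge0 // sqr_ge0.
have y2 l : y l 0 ^+ 2 = (x l 0 ^+ 2 + x (- l) 0 ^+ 2) / 2.
  by rewrite mxE sqr_sqrtr.
exists y; split.
- by move=> l; rewrite !mxE opprK addrC.
- by move=> l; rewrite mxE sqrtr_ge0.
- apply: eq_card => l; rewrite !inE -(sqrf_eq0 (y l 0)) y2.
  rewrite mulf_eq0 invr_eq0 (pnatr_eq0 _ 2) orbF.
  by rewrite paddr_eq0 ?sqr_ge0 // !sqrf_eq0 negb_and.
rewrite !gram_cyc_orbit; apply/matrixP => i j; rewrite !mxE.
have even : \sum_l x l 0 ^+ 2 * c ((i - j)%R * l) =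
    \sum_l x (- l) 0 ^+ 2 * c ((i - j)%R * l).
  by rewrite sum_oppI; apply: eq_bigr => l _; rewrite cosMNr.
under eq_bigr do rewrite mxE y2 mulrAC mulrDl.
under [RHS]eq_bigr do rewrite mxE.
by rewrite -mulr_suml big_split /= -even; field.
Qed.

Lemma gram_graph d (r : 'I_n -> 'cV[R]_d) G :
  has_graph (gram r) G <-> orth_rep G r.
Proof. by split=> rG i j ij; have := rG i j ij; rewrite mxE. Qed.

End Representations.

Theorem theorem6p12 (R : realType) (m : nat) (S : {set 'I_m.+1}) (k : nat)
    (S0 : 0 \notin S) (SN : forall s : 'I_m.+1, s \in S -> - s \in S) :
  [<-> exists A : 'M[R]_m.+1,
         [/\ positive_semidefinite A, circulant A, \rank A = k
           & has_graph A (circ_graph S)];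
       exists (d : nat) (r : 'I_m.+1 -> 'cV[R]_d),
         [/\ orth_rep (circ_graph S) r, cyclically_symmetric r
           & rep_rank r = k];
       exists x : 'cV[R]_m.+1,
         [/\ nonneg_vec x, weight x = k
           & orth_rep (circ_graph S) (fun i : 'I_m.+1 => cyc_mx R m ^+ i *m x)];
       exists x : 'cV[R]_m.+1,
         [/\ balanced x, nonneg_vec x, #|supp x| = k
           & orth_rep (circ_graph S) (fun i : 'I_m.+1 => cyc_mx R m ^+ i *m x)]].
Proof.
tfae.
- move=> [A [psdA circA rankA graphA]].
  have [x [_ _ Ax]] := psd_circulant_orbit psdA circA.
  exists m.+1, (cyc_orbit x); split; last by rewrite -rank_gram -Ax.
    by apply/gram_graph; rewrite -Ax.
  exact: cyc_orbit_symmetric.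
- move=> [d [r [rG r_sym r_rank]]].
  have [x [x_even x_ge0 Gx]] := psd_circulant_orbit (gram_psd r) (circulant_gram r_sym).
  exists x; split=> //.
    by rewrite balanced_weight // -gram_cyc_rank // -Gx rank_gram.
  by apply/(gram_graph (cyc_orbit x)); rewrite -Gx; apply/gram_graph.
- move=> [x [_ x_weight xG]]; have [y [y_even y_ge0 y_supp Gy]] := balance x.
  exists y; split=> //; first by rewrite y_supp.
  by apply/(gram_graph (cyc_orbit y)); rewrite Gy; apply/gram_graph.
- move=> [x [x_even _ x_supp xG]]; exists (gram (cyc_orbit x)); split.
  + exact: gram_psd.
  + exact/circulant_gram/cyc_orbit_symmetric.
  + by rewrite gram_cyc_rank.
  + exact/gram_graph.
Qed.
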